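(* Let $d\geqslant 1$ and let $1\leqslant\gamma_1\leqslant\cdots\leqslant\gamma_{d-1}$ be integers independent of $n$. Put $\Gamma=\{1,\gamma_1,\ldots,\gamma_{d-1}\}$ and, for $n$ with $\gamma_{d-1}\leqslant\lfloor n/2\rfloor$, let $C_n^\Gamma$ be the circulant graph with $n$ vertices and generators $\Gamma$. Let $\det^\ast\Delta_{C_n^\Gamma}$ be the product of the non-zero eigenvalues of the Laplacian on $C_n^\Gamma$. Then as $n\rightarrow\infty$ $$\log\det{}^\ast\Delta_{C_n^\Gamma}=n\int_0^\infty\left(e^{-t}-e^{-2dt}I_0^\Gamma(2t,\ldots,2t)\right)\frac{dt}{t}+2\log n-\log c_\Gamma+o(1),$$ where $c_\Gamma=1+\sum_{i=1}^{d-1}\gamma_i^2$ and $$I_0^\Gamma(2t,\ldots,2t)=\frac{1}{2\pi}\int_{-\pi}^\pi e^{2t\left(\cos w+\sum_{i=1}^{d-1}\cos(\gamma_iw)\right)}dw.$$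
   Context: The circulant graph $C_n^\Gamma$ with $\Gamma=\{1,\gamma_1,\ldots,\gamma_{d-1}\}$ is the $2d$-regular graph with vertex set $\mathbb{Z}/n\mathbb{Z}$ in which each vertex $v$ is connected to $v\pm1$ and $v\pm\gamma_i$ mod $n$ for $i=1,\ldots,d-1$ (edges counted with multiplicity). Its combinatorial Laplacian is $\Delta f(v)=\sum_{y\sim v}(f(v)-f(y))$, the sum being over the $2d$ neighbours of $v$ (with multiplicity); its eigenvalues (with multiplicity) are $\lambda_j=2d-2\cos(2\pi j/n)-2\sum_{i=1}^{d-1}\cos(2\pi\gamma_ij/n)$, $j=0,1,\ldots,n-1$. *)

(* Defs.v *)
From HB Require Import structures.
From mathcomp Require Export all_boot all_order all_algebra.
From mathcomp Require Export all_classical all_reals all_analysis.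

Set Implicit Arguments.
Unset Strict Implicit.
Unset Printing Implicit Defensive.

Export Order.TTheory GRing.Theory Num.Theory numFieldNormedType.Exports.

Local Open Scope classical_set_scope.
Local Open Scope ring_scope.

(* The vertex set Z/nZ is represented by the residues 'I_n.  The neighbour     *)
(* v - g is encoded by v = y + g mod n, so that every g in Gam contributes      *)
(* exactly two neighbours of v, which may coincide with each other (when        *)
(* 2 g = 0 mod n) or with the neighbours contributed by other generators.       *)
Definition circulant_mult (n : nat) (Gam : seq nat) (v y : 'I_n) : nat :=
  (\sum_(g <- Gam) ((y == v + g %[mod n]) + (v == y + g %[mod n])))%N.

Definition laplacian (R : nzRingType) (n : nat) (Gam : seq nat) (f : 'rV[R]_n) :
    'rV[R]_n :=
  \row_v \sum_(y < n) (f 0 v - f 0 y) *+ circulant_mult Gam v y.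

Fact laplacian_is_linear (R : nzRingType) (n : nat) (Gam : seq nat) :
  linear (@laplacian R n Gam).
Proof.
move=> a f g; apply/rowP => v; rewrite !mxE mulr_sumr -big_split /=.
apply: eq_bigr => y _.
by rewrite !mxE mulrnAr -mulrnDl mulrBr opprD addrACA.
Qed.

HB.instance Definition _ (R : nzRingType) (n : nat) (Gam : seq nat) :=
  GRing.isLinear.Build R 'rV[R]_n 'rV[R]_n _ (@laplacian R n Gam)
    (@laplacian_is_linear R n Gam).

Definition laplacian_mx (R : nzRingType) (n : nat) (Gam : seq nat) : 'M[R]_n :=
  lin1_mx (@laplacian R n Gam).

(* Meant for matrices whose eigenvalues all lie in R, such as real symmetric    *)
(* matrices; eigenvalues are repeated according to algebraic multiplicity.      *)
Definition det_star (R : fieldType) (n : nat) (A : 'M[R]_n) : R :=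
  \big[*%R/1]_(x \in [set x : R | eigenvalue A x /\ x != 0])
     x ^+ mup x (char_poly A).

(* I_0^Gamma(x, ..., x) for Gamma = {1} together with the elements of gam. *)
Definition besselI0 (R : realType) (gam : seq nat) (x : R) : R :=
  (2 * pi)^-1 *
  (\int[lebesgue_measure]_(w in `[- pi, pi])
     expR (x * (cos w + \sum_(g <- gam) cos (g%:R * w))))%R.

Definition circulant_integrand (R : realType) (d : nat) (gam : seq nat)
    (t : R) : R :=
  (expR (- t) - expR (- (2 * d%:R * t)) * besselI0 gam (2 * t)) / t.

Definition c_Gam (gam : seq nat) : nat := (1 + \sum_(g <- gam) g ^ 2)%N.

(* Main.v *)
Require Import Defs.
From mathcomp Require Import measurable_realfun complex ring lra.

(* The eigenvalues are values of the symbol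
   lam(w) = sum over g in Gamma of (2 - 2 cos (g w)), which factors as
   (2 - 2 cos w) q(w), where q = 1 + (sum of Fejer kernels) >= 1 is a
   trigonometric polynomial with q(0) = c_Gamma.  The first factor contributes
   exactly n^2 to det*; since ln q is smooth and periodic, its midpoint Riemann
   sums approximate n times its mean up to O(1/n), and the missing term j = 0
   gives - ln c_Gamma.  On the integral side, Frullani's formula
   int (e^-t - e^(-t lam)) dt/t = ln lam has an integrand of constant sign, so
   that Fubini reduces the claim to the mean of ln lam being the mean of ln q,
   that is, to int ln (2 - 2 cos w) dw = 0. *)

Set Implicit Arguments.
Unset Strict Implicit.
Unset Printing Implicit Defensive.

Local Open Scope classical_set_scope.
Local Open Scope ring_scope.

(** * Increments and primitives *)

(** The obstacle is the zero of lam at w = 0: ln lam is unbounded there, so no regularity of it can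
    bound the error of its Riemann sums. Dividing by 2 - 2 cos w isolates this zero, and the Riemann
    sum error then concerns ln q alone, which is bounded because q >= 1. The isolated factor obeys
    exact identities: its product over the roots of unity comes from the factorization of X^n - 1,
    and its logarithmic mean vanishes because |1 - z^2| = |1 - z| |1 + z| makes the integral
    reproduce half of itself. That integral is improper at 0, so the identity is used in a
    truncated, quantitative form, which yields integrability together with the value. Changes of
    variable in integrals are carried out by comparing derivatives of a primitive. *)

Lemma le_abs_increment (R : realType) (F f : R -> R) (a b M : R) : a <= b ->
  (forall x, a <= x <= b -> is_derive x 1 F (f x)) ->
  (forall x, a <= x <= b -> `|f x| <= M) ->
  `|F b - F a| <= M * (b - a).
Proof.
move=> ab dF fM.
have [||c cab ->] := @MVT_segment R F f a b ab.
- by move=> x /andP[xa xb]; apply: dF; move: xa xb; rewrite !bnd_simp => /ltW-> /ltW->.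
- apply: derivable_within_continuous => x; rewrite in_itv/= => xab.
  by case: (dF x xab).
rewrite normrM (ger0_norm (_ : 0 <= b - a)) ?subr_ge0//.
by apply: ler_wpM2r; rewrite ?subr_ge0// fM// -in_itv.
Qed.

(** The derivative is claimed only in the open interval, so each use takes an interval larger than
    the range of integration. *)
Lemma primitive_ex (R : realType) (G : R -> R) (a b : R) :
  {in `[a, b], continuous G} ->
  exists F : R -> R,
    (forall x, a < x < b -> is_derive x 1 F (G x)) /\
    (forall x y, a < x -> x <= y -> y < b ->
       (\int[lebesgue_measure]_(t in `[x, y]) G t)%R = F y - F x).
Proof.
move=> cG.
have iG x y : a <= x -> y <= b ->
    (@lebesgue_measure R).-integrable `[x, y] (EFin \o G).
  move=> ax yb; apply: continuous_compact_integrable; first exact: segment_compact.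
  apply: continuous_in_subspaceT => z; rewrite inE/= in_itv/= => /andP[xz zy].
  by apply: cG; rewrite in_itv/= (le_trans ax xz) (le_trans zy yb).
exists (fun x => (\int[lebesgue_measure]_(t in `[a, x]) G t)%R); split.
  move=> x /andP[ax xb].
  have [|dF <-] := @continuous_FTC1_closed R G a x b xb (iG _ _ (lexx a) (lexx b)) ax.
    by apply: cG; rewrite in_itv/= !ltW.
  by rewrite derive1E; apply/derivableP.
move=> x y ax xy yb.
rewrite Rintegral_itvB ?bnd_simp ?(ltW ax)//; last exact/iG/ltW.
by rewrite Rintegral_itv_obnd_cbnd//; apply: integrableS (iG _ _ (ltW ax) (ltW yb)) => //;
  apply: subset_itvr; rewrite bnd_simp.
Qed.

(** * Functions with bounded second differences *)

Lemma abs_sin_le (R : realType) (x : R) : `|sin x| <= `|x|.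
Proof.
wlog x0 : x / 0 <= x => [H|].
  case/orP: (le_total 0 x) => [/H//|x0].
  by rewrite -normrN -sinN -[leRHS]normrN; apply: H; rewrite oppr_ge0.
have := @le_abs_increment R sin cos 0 x 1 x0 _ _.
rewrite sin0 !subr0 mul1r (ger0_norm x0); apply => y _.
exact: cos_max.
Qed.

(** The linear bound serves first differences of trigonometric functions, the quadratic one their
    second differences. *)
Lemma abs_cos_sub1_le (R : realType) (x : R) :
  `|cos x - 1| <= `|x| /\ `|cos x - 1| <= x ^+ 2.
Proof.
have -> : cos x - 1 = - (2 * sin (x / 2) ^+ 2).
  rewrite sin2cos2; have -> : cos x = cos (x / 2 *+ 2).
    by congr cos; rewrite mulr2n; field.
  by rewrite cos_mulr2n; ring.
rewrite normrN normrM normrX (gtr0_norm (_ : 0 < 2))//.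
have := abs_sin_le (x / 2); have := sin_max (x / 2); have := normr_ge0 (sin (x / 2)).
rewrite normrM (gtr0_norm (_ : 0 < 2^-1)) ?invr_gt0//.
rewrite (_ : x ^+ 2 = `|x| ^+ 2); last by rewrite -normrX ger0_norm ?sqr_ge0.
by move: `|sin _| (`|x|) => a b ? ? ?; split; nra.
Qed.

Section second_order_bounded.
Context {R : realType}.
Implicit Types (f g : R -> R) (C x u : R).

(* Replaces C^2 bounds: it is stable under products and under ln on [1, +oo[,
   and it is all that the midpoint rule needs. *)
Definition second_order_bound C f := forall x u,
  [/\ `|f x| <= C, `|f (x + u) - f x| <= C * `|u| &
      `|f (x + u) + f (x - u) - 2 * f x| <= C * u ^+ 2].

Lemma second_order_boundW C C' f : C <= C' ->
  second_order_bound C f -> second_order_bound C' f.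
Proof.
move=> CC' fC x u; have [h1 h2 h3] := fC x u; split.
- exact: le_trans CC'.
- by apply: le_trans h2 _; exact: ler_wpM2r.
- by apply: le_trans h3 _; apply: ler_wpM2r => //; exact: sqr_ge0.
Qed.

Lemma second_order_bound_cst c : second_order_bound `|c| (fun=> c).
Proof.
move=> x u; split => //; first by rewrite subrr normr0 mulr_ge0.
rewrite (_ : c + c - 2 * c = 0); last by ring.
by rewrite normr0 mulr_ge0// sqr_ge0.
Qed.

Lemma second_order_boundD C f g : second_order_bound C f ->
  second_order_bound C g -> second_order_bound (2 * C) (fun x => f x + g x).
Proof.
move=> fC gC x u; have [f1 f2 f3] := fC x u; have [g1 g2 g3] := gC x u; split.
- by apply: le_trans (ler_normD _ _) _; lra.
- rewrite (_ : _ - _ = (f (x + u) - f x) + (g (x + u) - g x)); last by ring.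
  by apply: le_trans (ler_normD _ _) _; lra.
- rewrite (_ : _ - _ = (f (x + u) + f (x - u) - 2 * f x) +
                       (g (x + u) + g (x - u) - 2 * g x)); last by ring.
  by apply: le_trans (ler_normD _ _) _; lra.
Qed.

Lemma second_order_bound_ge0 C f : second_order_bound C f -> 0 <= C.
Proof. by move=> /(_ 0 0)[+ _ _]; apply: le_trans. Qed.

Lemma second_order_boundM C f g : second_order_bound C f ->
  second_order_bound C g -> second_order_bound (4 * C ^+ 2) (fun x => f x * g x).
Proof.
move=> fC gC x u; have C0 := second_order_bound_ge0 fC.
have [f1 f2 f3] := fC x u; have [g1 g2 g3] := gC x u.
have [_ f2' _] := fC x (- u); have [_ g2' _] := gC x (- u).
rewrite normrN in f2' g2'.
have mul_le (a b A B : R) : `|a| <= A -> `|b| <= B -> `|a * b| <= A * B.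
  by move=> aA bB; rewrite normrM ler_pM.
have u2 : u ^+ 2 = `|u| ^+ 2 by rewrite -normrX ger0_norm ?sqr_ge0.
split.
- by apply: le_trans (mul_le _ _ _ _ f1 g1) _; have := sqr_ge0 C; lra.
- rewrite (_ : _ - _ = (f (x + u) - f x) * g (x + u) + f x * (g (x + u) - g x)); last by ring.
  have [g1' _ _] := gC (x + u) 0.
  apply: le_trans (ler_normD _ _) _.
  have := mul_le _ _ _ _ f2 g1'; have := mul_le _ _ _ _ f1 g2.
  have : 0 <= C ^+ 2 * `|u| by rewrite mulr_ge0 ?sqr_ge0.
  lra.
(* Discrete Leibniz rule for second differences. Each of the four terms is at most C^2 u^2, whence
   the constant 4 C^2. *)
- rewrite (_ : _ - _ = (f x * (g (x + u) + g (x - u) - 2 * g x) +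
      (f (x + u) + f (x - u) - 2 * f x) * g x) +
      ((f (x + u) - f x) * (g (x + u) - g x) +
      (f (x - u) - f x) * (g (x - u) - g x))); last by ring.
  apply: le_trans (ler_normD _ _) _; apply: le_trans (lerD (ler_normD _ _) (ler_normD _ _)) _.
  have := mul_le _ _ _ _ f1 g3; have := mul_le _ _ _ _ f3 g1.
  have := mul_le _ _ _ _ f2 g2; have := mul_le _ _ _ _ f2' g2'.
  by rewrite u2; lra.
Qed.

Definition second_order_bounded f := exists C, second_order_bound C f.

Lemma second_order_boundedD f g : second_order_bounded f ->
  second_order_bounded g -> second_order_bounded (fun x => f x + g x).
Proof.
move=> [C fC] [D gD]; exists (2 * Num.max C D); apply: second_order_boundD.
- by apply: second_order_boundW fC; rewrite le_max lexx.
- by apply: second_order_boundW gD; rewrite le_max lexx orbT.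
Qed.

Lemma second_order_boundedM f g : second_order_bounded f ->
  second_order_bounded g -> second_order_bounded (fun x => f x * g x).
Proof.
move=> [C fC] [D gD]; exists (4 * Num.max C D ^+ 2); apply: second_order_boundM.
- by apply: second_order_boundW fC; rewrite le_max lexx.
- by apply: second_order_boundW gD; rewrite le_max lexx orbT.
Qed.

Lemma second_order_bounded_cst c : second_order_bounded (fun=> c).
Proof. by exists `|c|; exact: second_order_bound_cst. Qed.

Lemma second_order_bounded_sum I (s : seq I) (P : pred I) (F : I -> R -> R) :
  (forall i, second_order_bounded (F i)) ->
  second_order_bounded (fun x => \sum_(i <- s | P i) F i x).
Proof.
move=> HF; elim: s => [|i s IH].
  by under eq_fun do rewrite big_nil; exact: second_order_bounded_cst.
under eq_fun do rewrite big_cons.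
by case: (P i) => //; exact: second_order_boundedD.
Qed.

Lemma second_order_bounded_cos_sin (k : R) :
  second_order_bounded (fun x => cos (k * x)) /\
  second_order_bounded (fun x => sin (k * x)).
Proof.
pose C := 2 + 2 * `|k| + 2 * k ^+ 2.
have k2 : 0 <= k ^+ 2 := sqr_ge0 k.
have k0 : 0 <= `|k| := normr_ge0 k.
have mul_le (a b A B : R) : `|a| <= A -> `|b| <= B -> `|a * b| <= A * B.
  by move=> aA bB; rewrite normrM ler_pM.
have C1 : 1 <= C by rewrite /C; lra.
(* By the addition formulas, the first and second differences of cos (k x) and sin (k x) both have
   the shape bounded here, with (a, b) = (cos, - sin) and (sin, cos) respectively. *)
have tri a b u : `|a| <= 1 -> `|b| <= 1 ->
    [/\ `|a| <= C, `|a * (cos (k * u) - 1) + b * sin (k * u)| <= C * `|u| &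
       `|a * (cos (k * u) - 1) * 2| <= C * u ^+ 2].
  move=> a1 b1; split; first exact: le_trans C1.
  - apply: le_trans (ler_normD _ _) _.
    have := mul_le _ _ _ _ a1 (abs_cos_sub1_le (k * u)).1.
    have := mul_le _ _ _ _ b1 (abs_sin_le (k * u)).
    rewrite (normrM k u) !mul1r /C => h1 h2.
    have : 0 <= k ^+ 2 * `|u| by rewrite mulr_ge0.
    have := normr_ge0 u; have : 0 <= `|k| * `|u| by rewrite mulr_ge0.
    lra.
  - have := mul_le _ _ _ _ a1 (abs_cos_sub1_le (k * u)).2.
    rewrite (normrM _ 2) (gtr0_norm (_ : 0 < 2))// mul1r exprMn /C => h.
    have u2 : 0 <= u ^+ 2 := sqr_ge0 u.
    have : 0 <= `|k| * u ^+ 2 by rewrite mulr_ge0.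
    have : 0 <= k ^+ 2 * u ^+ 2 by rewrite mulr_ge0.
    lra.
split; exists C => x u; rewrite !(mulrDr, mulrN).
- have [||h1 h2 h3] := tri (cos (k * x)) (- sin (k * x)) u;
    rewrite ?normrN ?cos_max ?sin_max//.
  split => //; rewrite cosD ?cosB.
    rewrite (_ : _ - _ = cos (k * x) * (cos (k * u) - 1) +
                         - sin (k * x) * sin (k * u)) //; ring.
  by rewrite (_ : _ - _ = cos (k * x) * (cos (k * u) - 1) * 2) //; ring.
- have [||h1 h2 h3] := tri (sin (k * x)) (cos (k * x)) u; rewrite ?cos_max ?sin_max//.
  split => //; rewrite sinD ?sinB.
    rewrite (_ : _ - _ = sin (k * x) * (cos (k * u) - 1) +
                         cos (k * x) * sin (k * u)) //; ring.
  by rewrite (_ : _ - _ = sin (k * x) * (cos (k * u) - 1) * 2) //; ring.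
Qed.

Lemma second_order_bounded_ln f : second_order_bounded f ->
  (forall x, 1 <= f x) -> second_order_bounded (fun x => ln (f x)).
Proof.
move=> [C fC] f1; have C0 := second_order_bound_ge0 fC.
have ln_sub (a b : R) : 1 <= a -> 1 <= b -> `|ln a - ln b| <= `|a - b|.
  wlog ab : a b / a <= b => [H a1 b1|a1 b1].
    have [|/ltW] := leP a b => ab; first exact: H.
    by rewrite distrC (distrC a); exact: H.
  have a0 : 0 < a by lra.
  have b0 : 0 < b by lra.
  rewrite distrC (distrC a) !ger0_norm ?subr_ge0//; last first.
    by rewrite ler_ln ?posrE.
  rewrite -ln_div ?posrE//.
  have -> : b / a = 1 + (b - a) / a by field; rewrite gt_eqF.
  have h : 0 <= (b - a) / a by rewrite divr_ge0 ?subr_ge0// ltW.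
  apply: (le_trans (le_ln1Dx _)); first by lra.
  by rewrite ler_pdivrMr//; nra.
have f0 x : 0 < f x by apply: lt_le_trans (f1 x).
(* C bounds the values and first differences of ln f. The second difference of ln f compares ln of f
   (x + u) f (x - u) with ln of f(x)^2; these arguments differ by at most 2 C^2 u^2. *)
exists (C + 2 * C ^+ 2) => x u.
have [h1 h2 h3] := fC x u; have [_ h2' _] := fC x (- u).
rewrite normrN in h2'.
have u2 : u ^+ 2 = `|u| ^+ 2 by rewrite -normrX ger0_norm ?sqr_ge0.
split.
- have := ln_sub (f x) 1 (f1 x) (lexx 1); rewrite ln1 subr0 => /le_trans; apply.
  have := f1 x; move: h1; rewrite !ger0_norm ?subr_ge0// ?(ltW (f0 _))//.
  by have := sqr_ge0 C; lra.
- apply: (le_trans (ln_sub _ _ (f1 _) (f1 _))); apply: (le_trans h2).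
  by rewrite ler_wpM2r// lerDl mulr_ge0// sqr_ge0.
- (* ln is 1-Lipschitz on [1, +oo[. *)
  rewrite (_ : _ - _ = ln (f (x + u) * f (x - u)) - ln (f x * f x)); last first.
    by rewrite !lnM ?posrE//; ring.
  have mul1 (a b : R) : 1 <= a -> 1 <= b -> 1 <= a * b by nra.
  apply: (le_trans (ln_sub _ _ (mul1 _ _ (f1 _) (f1 _)) (mul1 _ _ (f1 _) (f1 _)))).
  rewrite (_ : _ - _ = f x * (f (x + u) + f (x - u) - 2 * f x) +
             (f (x + u) - f x) * (f (x - u) - f x)); last by ring.
  apply: (le_trans (ler_normD _ _)); rewrite !normrM.
  have := ler_pM (normr_ge0 _) (normr_ge0 _) h1 h3.
  have := ler_pM (normr_ge0 _) (normr_ge0 _) h2 h2'.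
  rewrite u2; move: (`|u|) (_ * _) (`|f x| * _) => v a b.
  have : 0 <= C * v ^+ 2 by rewrite mulr_ge0 ?sqr_ge0.
  nra.
Qed.

Lemma second_order_bounded_continuous f : second_order_bounded f -> continuous f.
Proof.
move=> [C fC] x; have C0 := second_order_bound_ge0 fC.
apply/cvgrPdist_le => e e0; near=> y.
have [_ + _] := fC x (y - x); rewrite subrKC distrC => /le_trans; apply.
have : `|y - x| <= e / (C + 1).
  rewrite distrC; near: y; apply: cvgr_dist_le => //.
  by rewrite divr_gt0// ltr_wpDl.
rewrite ler_pdivlMr ?ltr_wpDl//; have := normr_ge0 (y - x).
by move: `|_| => v; nra.
Unshelve. all: by end_near. Qed.

End second_order_bounded.

(** * Symmetric integrals and Riemann sums *)

(** One statement for translations, reflections and dilations; this is why factors such as [1 *] and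
    [-1 *] are kept in later proofs. *)
Lemma is_derive_comp_affine (R : realType) (F : R -> R) (df c s u : R) :
  is_derive (c + s * u) 1 F df -> is_derive u 1 (fun v => F (c + s * v)) (s * df).
Proof.
move=> dF.
have dg : is_derive u 1 (fun v => c + s * v) s.
  by apply: is_derive_eq; rewrite add0r mul1r /GRing.scale/= mulr1.
rewrite mulrC; exact: (@is_derive1_comp R F _ u df s).
Qed.

Lemma is_derive_opp_fun (R : realType) (f : R -> R) (df x : R) :
  is_derive x 1 f df -> is_derive x 1 (fun y => - f y) (- df).
Proof. by move=> fdf; exact: is_deriveN. Qed.

Lemma zero_derive_eq (R : realType) (F : R -> R) (a b : R) : a <= b ->
  (forall x, a <= x <= b -> is_derive x 1 F 0) -> F a = F b.
Proof.
move=> ab dF; apply/esym/eqP; rewrite -subr_eq0 -normr_le0.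
have := @le_abs_increment R F (fun=> 0) a b 0 ab dF _.
by rewrite mul0r; apply => x _; rewrite normr0.
Qed.

(** F (c + x) + F (c - x) has derivative G (c + x) - G (c - x) = 0. The first half is used with c =
    0 for the Bessel integral, the second with c = pi to fold a full period. *)
Lemma symmetric_integral (R : realType) (G : R -> R) (c a : R) : 0 <= a ->
  {in `[c - a - 1, c + a + 1], continuous G} -> (forall x, G (c - x) = G (c + x)) ->
  (\int[lebesgue_measure]_(t in `[(c - a)%R, (c + a)%R]) G t =
     2 * \int[lebesgue_measure]_(t in `[c, (c + a)%R]) G t)%R /\
  (\int[lebesgue_measure]_(t in `[(c - a)%R, (c + a)%R]) G t =
     2 * \int[lebesgue_measure]_(t in `[(c - a)%R, c]) G t)%R.
Proof.
move=> a0 /primitive_ex[F [dF IF]] sG; rewrite !IF; [|lra..].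
suff : F (c + 1 * 0) + F (c + -1 * 0) = F (c + 1 * a) + F (c + -1 * a).
  by rewrite !(mulr0, addr0, mul1r, mulN1r, subr0) => H; split; lra.
apply: (@zero_derive_eq R (fun x => F (c + 1 * x) + F (c + - 1 * x))) => // x xa.
have d1 := @is_derive_comp_affine R F _ c 1 x (dF _ _).
have d2 := @is_derive_comp_affine R F _ c (-1) x (dF _ _).
apply: (@is_derive_eq _ _ _ _ _ _ _ (1 * G (c + 1 * x) + -1 * G (c + -1 * x))); last first.
  by rewrite !mul1r !mulN1r sG subrr.
by apply: is_deriveD; [apply: d1|apply: d2]; lra.
Qed.

(** The nodes are read as midpoints of cells of length h = T / n. Each cell contributes an error at
    most C h^3, and n such errors divided by h give C h^2 n = C T^2 / n. *)
Lemma periodic_riemann_sum_error (R : realType) (G : R -> R) (C T : R) (n : nat) :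
  0 < T -> (0 < n)%N -> second_order_bound C G -> (forall x, G (x + T) = G x) ->
  `|\sum_(j < n) G (T * j%:R / n%:R) -
      n%:R / T * (\int[lebesgue_measure]_(t in `[0%R, T]) G t)%R| <= C * T ^+ 2 / n%:R.
Proof.
move=> T0 n0 GC pG; have C0 := second_order_bound_ge0 GC.
have cG : {in `[- (3 * T), 3 * T], continuous G}.
  by move=> x _; apply: second_order_bounded_continuous; exists C.
have [F [dF IF]] := primitive_ex cG.
rewrite IF; [|lra..].
have n0' : 0 < n%:R :> R by rewrite ltr0n.
pose h : R := T / n%:R.
have h0 : 0 < h by rewrite divr_gt0.
have nh : n%:R * h = T by rewrite /h mulrC divfK// gt_eqF.
have hT : h <= T.
  have n1 : 1 <= n%:R :> R by rewrite ler1n.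
  by rewrite ler_pdivrMr//; nra.
(* Midpoint rule on [x - h / 2, x + h / 2], so that the primitives telescope. *)
have mid x : 0 <= x <= T ->
    `|F (x + h / 2) - F (x - h / 2) - h * G x| <= C * h ^+ 2 * h.
  move=> xT.
  (* The derivative of [E] is exactly the second difference of G at x, hence at most C h^2 on
     [0, h / 2]. *)
  pose E u := F (x + 1 * u) + - F (x + - 1 * u) + - (2 * G x * u).
  have := @le_abs_increment R E
    (fun u => G (x + u) + G (x - u) - 2 * G x) 0 (h / 2) (C * h ^+ 2) _ _ _.
  rewrite /E !(mulr0, mulN1r, mul1r, addr0, subr0) addrN subr0.
  rewrite (_ : 2 * G x * (h / 2) = h * G x); last by field.
  move=> H; apply: le_trans (H _ _ _) _ => [||u uh|].
  - lra.
  - move=> u uh.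
    have d1 := @is_derive_comp_affine R F _ x 1 u (dF _ _).
    have d2 := @is_derive_comp_affine R F _ x (-1) u (dF _ _).
    have d3 : is_derive u 1 (fun v => 2 * G x * v) (2 * G x).
      by apply: is_derive_eq; rewrite /GRing.scale/= mulr1.
    apply: (@is_derive_eq _ _ _ _ _ _ _
      (1 * G (x + 1 * u) + - (- 1 * G (x + - 1 * u)) + - (2 * G x))).
      apply: is_deriveD.
      apply: is_deriveD; first by apply: d1; lra.
      by apply: is_derive_opp_fun; apply: d2; lra.
    by rewrite !mulN1r !mul1r opprK.
  - have [_ _ /le_trans] := GC x u; apply.
    by apply: ler_wpM2l => //; rewrite ler_sqr ?nnegrE; lra.
  - apply: ler_wpM2l; last lra.
    by rewrite mulr_ge0// sqr_ge0.
(* The cells tile [- h / 2, T - h / 2] instead of [0, T]; periodicity makes both integrals equal. *)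
have shift : F T - F 0 = F (T - h / 2) - F (- (h / 2)).
  apply/esym; have := @zero_derive_eq R
    (fun x => F (T + 1 * x) + - F (0 + 1 * x)) (- (h / 2)) 0 _ _.
  rewrite !mul1r !add0r addr0; apply; first by lra.
  move=> x xh.
  have d1 := @is_derive_comp_affine R F _ T 1 x (dF _ _).
  have d2 := @is_derive_comp_affine R F _ 0 1 x (dF _ _).
  apply: (@is_derive_eq _ _ _ _ _ _ _ (1 * G (T + 1 * x) + - (1 * G (0 + 1 * x)))).
    by apply: is_deriveD; [apply: d1|apply: is_derive_opp_fun; apply: d2]; lra.
  by rewrite !mul1r add0r addrC addrC (addrC T) pG subrr.
have tele : F (T - h / 2) - F (- (h / 2)) =
    \sum_(j < n) (F (j%:R * h + h / 2) - F (j%:R * h - h / 2)).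
  rewrite -nh; elim: (n) => [|m IH]; first by rewrite big_ord0 mul0r add0r subrr.
  rewrite big_ord_recr/= -IH -natr1.
  rewrite (_ : (m%:R + 1) * h - h / 2 = m%:R * h + h / 2); last by field.
  by ring.
have -> : \sum_(j < n) G (T * j%:R / n%:R) - n%:R / T * (F T - F 0) =
    - (h^-1 * \sum_(j < n)
         (F (j%:R * h + h / 2) - F (j%:R * h - h / 2) - h * G (j%:R * h))).
  rewrite sumrB -tele -shift -mulr_sumr [h^-1 * _]mulrBr mulKf ?gt_eqF// opprB.
  congr (_ - _ * _).
    by apply: eq_bigr => j _; rewrite /h; congr G; ring.
  by rewrite /h invf_div.
rewrite normrN normrM ger0_norm ?invr_ge0 ?(ltW h0)//.
apply: (@le_trans _ _ (h^-1 * (\sum_(j < n) (C * h ^+ 2 * h)))).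
  rewrite ler_wpM2l ?invr_ge0 ?(ltW h0)//.
  apply: le_trans (ler_norm_sum _ _ _) _; apply: ler_sum => j _; apply: mid.
  rewrite mulr_ge0 ?(ltW h0)//= -nh ler_wpM2r ?(ltW h0)// ler_nat.
  exact/ltnW/ltn_ord.
rewrite sumr_const card_ord -mulr_natl (_ : h^-1 * _ = C * h ^+ 2 * n%:R); last first.
  by field; rewrite gt_eqF.
by rewrite /h le_eqVlt; apply/orP; left; apply/eqP; field; rewrite gt_eqF.
Qed.

(** * The integral of the logarithm of the squared chord *)

(* |1 - e^(i w)|^2 *)
Definition chord2 (R : realType) (w : R) : R := 2 - 2 * cos w.

(** Squared form of |1 - z^2| = |1 - z| |1 + z|, where |1 + e^(i w)| is the chord at pi - w. *)
Lemma chord2_double (R : realType) (w : R) :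
  chord2 (2 * w) = chord2 w * chord2 (pi - w).
Proof.
rewrite /chord2 (mulr_natl w 2) cos_mulr2n cosB cospi sinpi.
by rewrite mul0r addr0; ring.
Qed.

Lemma chord2_gt0 (R : realType) (w : R) : 0 < w < 2 * pi -> 0 < chord2 w.
Proof.
move=> w0; have -> : chord2 w = 4 * sin (w / 2) ^+ 2.
  rewrite /chord2; have -> : cos w = cos (w / 2 *+ 2).
    by congr cos; rewrite mulr2n; field.
  by rewrite cos_mulr2n sin2cos2; ring.
by rewrite mulr_gt0// exprn_gt0// sin_gt0_pi//; lra.
Qed.

Lemma chord2_le4 (R : realType) (w : R) : chord2 w <= 4.
Proof. by rewrite /chord2; have := cos_geN1 w; lra. Qed.

Lemma continuous_chord2 (R : realType) : continuous (@chord2 R).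
Proof.
move=> x; apply: cvgB; first exact: cvg_cst.
by apply: cvgM; [exact: cvg_cst|exact: continuous_cos].
Qed.

Lemma continuous_ln_comp (R : realType) (f : R -> R) (x : R) :
  {for x, continuous f} -> 0 < f x -> {for x, continuous (fun y => ln (f y))}.
Proof.
move=> cf fx0; exact: (continuous_comp cf (continuous_ln fx0)).
Qed.

Lemma continuous_ln_chord2 (R : realType) (x : R) : 0 < x < 2 * pi ->
  {for x, continuous (fun w : R => ln (chord2 w))}.
Proof.
by move=> x0; apply: continuous_ln_comp; [exact: continuous_chord2|exact: chord2_gt0].
Qed.

Local Notation int_ln_chord2 x :=
  (\int[lebesgue_measure]_(w in `[x%R, pi]) ln (chord2 w))%R (only parsing).

(** Integrating the duplication formula from x to pi / 2 shows that the difference is exactly the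
    integral over [pi - x, pi], where 1 <= chord2 <= 4. *)
Lemma int_ln_chord2_double (R : realType) (x : R) : 0 < x <= pi / 2 ->
  `|int_ln_chord2 x - int_ln_chord2 (2 * x) / 2| <= x * ln 4.
Proof.
move=> x0; have pi0 := pi_gt0 R.
have cG : {in `[x / 2, 3 * pi / 2], continuous (fun w : R => ln (chord2 w))}.
  by move=> w; rewrite in_itv/= => wI; apply: continuous_ln_chord2; lra.
have [F [dF IF]] := primitive_ex cG.
rewrite !IF; [|lra..].
(* Integrated form of ln (chord2 (2 w)) = ln (chord2 w) + ln (chord2 (pi - w)). *)
have E : (F pi - F x) - (F pi - F (2 * x)) / 2 = F pi - F (pi - x).
  (* The left side is constant in x; at pi / 2, where x and pi - x meet, it reduces to - F(pi) /
     2. *)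
  suff : F x + - (2^-1 * F (0 + 2 * x)) + - F (pi + -1 * x) =
         F (pi / 2) + - (2^-1 * F (0 + 2 * (pi / 2))) + - F (pi + -1 * (pi / 2)).
    rewrite !(add0r, mulN1r) (_ : 2 * (pi / 2) = pi); last by field.
    rewrite (_ : pi - pi / 2 = pi / 2 :> R); last by field.
    by move=> H; lra.
  apply: (@zero_derive_eq R
    (fun x => F x + - (2^-1 * F (0 + 2 * x)) + - F (pi + -1 * x))); first lra.
  move=> y yx.
  have d1 : is_derive y 1 F (ln (chord2 y)) by apply: dF; lra.
  have d2 : is_derive y 1 (fun y => F (0 + 2 * y)) (2 * ln (chord2 (0 + 2 * y))).
    by apply: is_derive_comp_affine; apply: dF; lra.
  have d3 : is_derive y 1 (fun y => F (pi + -1 * y)) (-1 * ln (chord2 (pi + -1 * y))).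
    by apply: is_derive_comp_affine; apply: dF; lra.
  apply: (is_derive_eq (is_deriveD (is_deriveD d1 (is_deriveN (is_deriveZ 2^-1 d2)))
    (is_deriveN d3))); rewrite /GRing.scale/=.
  have s1 : 0 < chord2 y by apply: chord2_gt0; lra.
  have s2 : 0 < chord2 (pi - y) by apply: chord2_gt0; lra.
  by rewrite add0r mulKf// !mulN1r chord2_double lnM ?posrE//; ring.
rewrite E.
have := @le_abs_increment R F (fun w => ln (chord2 w)) (pi - x) pi (ln 4) _ _ _.
rewrite subKr [ln 4 * _]mulrC; apply; first lra.
  by move=> w wx; apply: dF; lra.
move=> w wx.
have s1 : 1 <= chord2 w.
  have : cos w <= 0.
    rewrite -oppr_ge0 -[w](subrK pi) cosDpi opprK; apply: cos_ge0_pihalf; lra.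
  by rewrite /chord2; lra.
rewrite ger0_norm ?ln_ge0// ler_ln ?posrE//; first exact: chord2_le4.
lra.
Qed.

(* With a_k the integral, a_(k+1) = a_k / 2 + O(2^-k), whence a_k = O(k 2^-k); the
   ratio 3 / 4 absorbs the factor k. *)
Lemma int_ln_chord2_le (R : realType) (k : nat) :
  `|int_ln_chord2 (pi / 2 ^+ k : R)| <= 2 * (pi * ln 4) * (3 / 4) ^+ k.
Proof.
have ln4 : 0 <= ln 4 :> R by rewrite ln_ge0//; lra.
have pi0 := pi_gt0 R.
have pln : 0 <= pi * ln 4 :> R by rewrite mulr_ge0// ltW.
elim: k => [|k IH].
  by rewrite !expr0 divr1 mulr1 set_itv1 Rintegral_set1 normr0 mulr_ge0.
have h : 0 < (pi : R) / 2 ^+ k.+1 <= pi / 2.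
  rewrite divr_gt0 ?exprn_gt0//= ler_pM2l// lef_pV2 ?posrE ?exprn_gt0//.
  by rewrite exprS ler_peMr// exprn_ege1// ler1n.
have := int_ln_chord2_double h.
rewrite (_ : 2 * (pi / 2 ^+ k.+1) = pi / 2 ^+ k); last first.
  by rewrite exprS; field; rewrite expf_neq0.
move: IH; set a := Rintegral _ _ _; set b := Rintegral _ _ _ => IH H.
have -> : b = a / 2 + (b - a / 2) by ring.
apply: (le_trans (ler_normD _ _)); rewrite normrM [`|2^-1|]gtr0_norm ?invr_gt0//.
(* With A = pi ln 4, halving the inductive bound gives A (3/4)^k, and adding A/2 (3/4)^k makes 2 A
   (3/4)^(k+1); this fixes the leading constant 2. *)
have : (pi : R) / 2 ^+ k.+1 * ln 4 <= 2^-1 * (pi * ln 4) * (3 / 4) ^+ k.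
  rewrite (_ : pi / 2 ^+ k.+1 * ln 4 = 2^-1 * (pi * ln 4) * (1 / 2) ^+ k); last first.
    by rewrite expr_div_n expr1n exprS; field; rewrite expf_neq0.
  rewrite ler_wpM2l//; first by rewrite mulr_ge0.
  by rewrite lerXn2r ?nnegrE; lra.
by rewrite [(3 / 4) ^+ k.+1]exprS; lra.
Qed.

(** The logarithm changes sign and is not yet known to be integrable, so monotone convergence is
    applied to ln 4 - ln chord2 >= 0 along the truncations [pi / 2^k, pi]. The finite limit pi ln 4
    gives integrability and the value at once. *)
Lemma ln_chord2_integral (R : realType) :
  (@lebesgue_measure R).-integrable `]0, pi] (fun w => (ln (chord2 w))%:E) /\
  (\int[lebesgue_measure]_(w in `]0%R, pi]) ln (chord2 w : R) = 0)%R.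
Proof.
have pi0 := pi_gt0 R.
pose mu := @lebesgue_measure R.
pose F (k : nat) : set R := `[pi / 2 ^+ k, pi]%classic.
have Fk k : 0 < (pi : R) / 2 ^+ k <= pi.
  rewrite divr_gt0 ?exprn_gt0//= ler_pdivrMr ?exprn_gt0// ler_pMr//.
  by rewrite exprn_ege1// ler1n.
have FE : \bigcup_i F i = `]0, pi]%classic.
  apply/seteqP; split => x /=.
    by move=> [k _]; rewrite /F/= !in_itv/= => /andP[xk ->]; rewrite andbT; have := Fk k; lra.
  rewrite in_itv/= => /andP[x0 xpi].
  have cv : (fun k => pi * (1 / 2) ^+ k : R) @ \oo --> (0 : R).
    rewrite -(mulr0 pi); apply: cvgM; first exact: cvg_cst.
    by apply: cvg_expr; rewrite ger0_norm; lra.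
  have [k _ /(_ k (leqnn k))] : \forall k \near \oo, pi * (1 / 2) ^+ k < x.
    by move/cvgr_lt: cv; apply.
  rewrite expr_div_n expr1n mul1r => /ltW kx; exists k => //.
  by rewrite /F/= in_itv/= kx.
have mF k : measurable (F k) by exact: measurable_itv.
have iF k : mu.-integrable (F k) (fun w => (ln (chord2 w))%:E).
  apply: (@continuous_compact_integrable _ (fun w => ln (chord2 w))).
    exact: segment_compact.
  apply: continuous_in_subspaceT => w; rewrite inE /F/= in_itv/= => /andP[kw wpi].
  by apply: continuous_ln_chord2; have := Fk k; lra.
have mln : measurable_fun `]0, pi] (fun w : R => ln (chord2 w)).
  rewrite -FE; apply/measurable_fun_bigcup => [|k]; first exact: mF.
  by apply/measurable_EFinP; exact: (measurable_int mu (iF k)).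
have ic : mu.-integrable `[0, pi] (fun=> (ln 4)%:E).
  apply: (@continuous_compact_integrable _ (fun=> ln 4)); first exact: segment_compact.
  by apply: continuous_subspaceT => ?; exact: cvg_cst.
pose g w : R := ln 4 - ln (chord2 w).
have g0 x : 0 < x <= pi -> 0 <= g x.
  move=> x0; rewrite subr_ge0 ler_ln ?posrE ?chord2_le4// chord2_gt0//; lra.
have cvg1 : (\int[mu]_(w in F k) (g w)%:E)%E @[k --> \oo] -->
            (\int[mu]_(w in `]0%R, pi]) (g w)%:E)%E.
  rewrite -FE; apply: ge0_nondecreasing_set_cvg_integral.
  - apply/nondecreasing_seqP => k; apply/subsetPset; apply: subset_itvr; rewrite bnd_simp.
    by rewrite ler_pM2l// lef_pV2 ?posrE ?exprn_gt0// ler_eXn2l ?ltr1n.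
  - exact: mF.
  - move=> k; apply/measurable_EFinP; apply: measurable_funB => //.
    apply/measurable_EFinP; exact: (measurable_int mu (iF k)).
  - move=> k x; rewrite /F/= in_itv/= => /andP[kx xpi]; rewrite lee_fin g0//.
    by have := Fk k; lra.
have muF k : (mu (F k) = (pi - pi / 2 ^+ k)%:E)%E.
  rewrite /mu /F lebesgue_measure_itv/= lte_fin; case: ltP => // h.
  suff -> : pi / 2 ^+ k = pi :> R by rewrite subrr.
  by have := Fk k; lra.
have IF k : (\int[mu]_(w in F k) (g w)%:E =
    (ln 4 * (pi - pi / 2 ^+ k) - int_ln_chord2 (pi / 2 ^+ k))%:E)%E.
  have mFk := mF k; rewrite integralB_EFin//; last first.
    apply: (@integrableS _ _ _ mu _ (F k) _ _ (mF k) _ ic) => //.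
    apply: subset_itvr; rewrite bnd_simp.
    by have := Fk k; lra.
  have -> : (\int[mu]_(x in F k) (ln 4)%:E = (ln 4 * (pi - pi / 2 ^+ k))%:E)%E.
    by rewrite EFinM -(muF k); exact: integral_cst.
  rewrite EFinB; congr (_ - _)%E.
  by rewrite /Rintegral fineK//; apply: integrable_fin_num; [exact: mF|exact: iF].
have cvgk (a c : R) : 0 < a < 1 -> (fun k => c * a ^+ k : R) @ \oo --> (0 : R).
  move=> a01; rewrite -(mulr0 c); apply: cvgM; first exact: cvg_cst.
  by apply: cvg_expr; rewrite ger0_norm; lra.
have cvg2 : (\int[mu]_(w in F k) (g w)%:E)%E @[k --> \oo] --> (ln 4 * pi)%:E.
  under eq_fun do rewrite IF.
  apply: cvg_EFin; first by near=> k.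
  rewrite (_ : ln 4 * pi = ln 4 * (pi - 0) - 0); last by rewrite !subr0.
  apply: cvgB.
    apply: cvgM; first exact: cvg_cst.
    apply: cvgB; first exact: cvg_cst.
    under eq_fun do rewrite -exprVn.
    by apply: cvgk; lra.
  apply/cvgr0Pnorm_le => e e0.
  near=> k; apply: (le_trans (int_ln_chord2_le _ k)).
  by near: k; apply: (cvgr_le _ (cvgk _ (2 * (pi * ln 4)) _)) => //; lra.
have Ig : (\int[mu]_(w in `]0%R, pi]) (g w)%:E = (ln 4 * pi)%:E)%E.
  by apply: cvg_unique cvg1 cvg2; exact: ereal_hausdorff.
have ig : mu.-integrable `]0, pi] (fun w => (g w)%:E).
  apply/integrableP; split.
    by apply/measurable_EFinP; exact: measurable_funB.
  rewrite [X in (X < _)%E](_ : _ = \int[mu]_(w in `]0%R, pi]) (g w)%:E)%E.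
    by rewrite Ig ltry.
  by apply: eq_integral => w; rewrite inE/= in_itv/= => w0; rewrite ger0_norm ?g0.
have ic' : mu.-integrable `]0, pi] (fun=> (ln 4)%:E).
  by apply: integrableS ic => //; apply: subset_itvr; rewrite bnd_simp.
have il : mu.-integrable `]0, pi] (fun w => (ln (chord2 w))%:E).
  apply: (@eq_integrable _ _ _ mu _ _ (fun w => (ln 4)%:E - (g w)%:E)%E) => //.
    by move=> w _; rewrite -EFinB /g subKr.
  exact: integrableB.
split => //.
have Ic : (\int[mu]_(w in `]0%R, pi]) (ln 4)%:E = (ln 4 * pi)%:E)%E.
  have muI : (mu [set` `]0%R, pi]] = pi%:E)%E.
    by rewrite /mu lebesgue_measure_itv/= lte_fin pi0 oppr0 adde0.
  by rewrite EFinM -muI; exact: integral_cst.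
have := Ig; rewrite integralB_EFin// Ic.
rewrite /Rintegral -[X in (_ - X)%E]fineK ?integrable_fin_num// -EFinB => -[] /eqP.
by rewrite subr_eq addrC -subr_eq subrr => /eqP.
Unshelve. all: by end_near. Qed.

(** * Fubini on product domains and Frullani's integral *)

Section product_domain.
Context {R : realType}.
Notation mu := (@lebesgue_measure R).
Variables (D E : set R) (f : R -> R -> R).
Hypotheses (mD : measurable D) (mE : measurable E).
Hypothesis mf : measurable_fun (D `*` E) (fun z : R * R => f z.1 z.2).

(** Extension by zero turns iterated integrals over the rectangle into iterated integrals over the
    whole plane. *)
Let F : R * R -> \bar R := (fun z => (f z.1 z.2)%:E) \_ (D `*` E).

Let mF : measurable_fun setT F.
Proof.
apply/(measurable_restrictT _ _).1; first exact: measurableX.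
exact/measurable_EFinP.
Qed.

Let FDE x y : F (x, y) = if (x \in D) && (y \in E) then (f x y)%:E else 0%E.
Proof. by rewrite /F patchE in_setX. Qed.

Let absFDE x y :
  (`|F (x, y)| = if (x \in D) && (y \in E) then `|f x y|%:E else 0)%E.
Proof. by rewrite FDE; case: ifP => //=; rewrite normr0. Qed.

Let patch12 (g : R -> R -> R) :
  (\int[mu]_x \int[mu]_y (if (x \in D) && (y \in E) then (g x y)%:E else 0) =
   \int[mu]_(x in D) \int[mu]_(y in E) (g x y)%:E)%E.
Proof.
rewrite [RHS]integral_mkcond; apply: eq_integral => x _.
rewrite patchE; case: (x \in D) => /=; last by rewrite integral0.
by rewrite [RHS]integral_mkcond; apply: eq_integral => y _; rewrite patchE.
Qed.

Let patch21 (g : R -> R -> R) :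
  (\int[mu]_y \int[mu]_x (if (x \in D) && (y \in E) then (g x y)%:E else 0) =
   \int[mu]_(y in E) \int[mu]_(x in D) (g x y)%:E)%E.
Proof.
rewrite [RHS]integral_mkcond; apply: eq_integral => y _.
rewrite patchE; case: (y \in E) => /=.
  rewrite [RHS]integral_mkcond; apply: eq_integral => x _; rewrite patchE.
  by case: (x \in D).
by under eq_integral do rewrite andbF; rewrite integral0.
Qed.

Lemma tonelli_setX : (forall x y, D x -> E y -> 0 <= f x y) ->
  (\int[mu]_(x in D) \int[mu]_(y in E) (f x y)%:E =
   \int[mu]_(y in E) \int[mu]_(x in D) (f x y)%:E)%E.
Proof.
move=> f0; rewrite -patch12 -patch21.
have := @fubini_tonelli _ _ _ _ R mu mu F mF.
under eq_integral do under eq_integral do rewrite FDE.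
move=> ->; last first.
  move=> [x y]; rewrite FDE; case: ifPn => // /andP[/set_mem Dx /set_mem Ey].
  by rewrite lee_fin f0.
by under eq_integral do under eq_integral do rewrite FDE.
Qed.

(** Absolute integrability is tested with the [D] variable innermost: in the application that
    variable is t, and the inner integral of the absolute value is known in closed form. *)
Lemma fubini_setX :
  (\int[mu]_(y in E) \int[mu]_(x in D) `|f x y|%:E < +oo)%E ->
  mu.-integrable D (fun x => \int[mu]_(y in E) (f x y)%:E)%E /\
  (\int[mu]_(x in D) \int[mu]_(y in E) (f x y)%:E =
   \int[mu]_(y in E) \int[mu]_(x in D) (f x y)%:E)%E.
Proof.
move=> fioo.
have iF : (mu \x mu)%E.-integrable setT F.
  apply/integrable21ltyP => //; move: fioo; rewrite -patch21.
  by under eq_integral do under eq_integral do rewrite -absFDE.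
split.
  apply/integrable_mkcond => //.
  have := integrable_fubini_F iF.
  apply: eq_integrable => // x _.
  rewrite /fubini_F patchE; case: ifPn => xD.
    by rewrite [RHS]integral_mkcond; apply: eq_integral => y _; rewrite FDE xD patchE.
  under eq_integral do rewrite FDE (negbTE xD).
  by rewrite integral0.
have := @Fubini _ _ _ _ R mu mu F iF.
under eq_integral do under eq_integral do rewrite FDE.
rewrite patch12 => ->.
under eq_integral do under eq_integral do rewrite FDE.
by rewrite patch21.
Qed.

End product_domain.

Lemma integral_is_derive (R : realType) (F f : R -> R) (a b : R) : a <= b ->
  {in `[a, b], continuous f} ->
  (forall x, a <= x <= b -> is_derive x 1 F (f x)) ->
  (\int[lebesgue_measure]_(x in `[a, b]) (f x)%:E = (F b - F a)%:E)%E.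
Proof.
rewrite le_eqVlt => /predU1P[<- _ _|ab cf dF].
  by rewrite set_itv1 integral_set1 subrr.
have cF x : a <= x <= b -> F y @[y --> x] --> F x.
  move=> /dF[dFx _]; apply: differentiable_continuous.
  exact/derivable1_diffP.
rewrite (continuous_FTC2 (F := F))//.
- apply: continuous_in_subspaceT => x; rewrite inE/=; exact: cf.
- split.
  + move=> x; rewrite in_itv/= => /andP[/ltW ax /ltW xb].
    by have /dF[] : a <= x <= b by rewrite ax.
  + by apply: cvg_at_right_filter; apply: cF; rewrite lexx ltW.
  + by apply: cvg_at_left_filter; apply: cF; rewrite lexx ltW.
- move=> x; rewrite in_itv/= => /andP[/ltW ax /ltW xb].
  by rewrite derive1E; have /dF[] : a <= x <= b by rewrite ax.
Qed.

Lemma continuous_expRZ (R : realType) (c : R) : continuous (fun x => expR (c * x)).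
Proof.
move=> x; apply: (@continuous_comp _ _ _ (fun x => c * x) expR); last exact: continuous_expR.
by apply: cvgM; [exact: cvg_cst|exact: cvg_id].
Qed.

Lemma is_derive_expRZ (R : realType) (c x : R) :
  is_derive x 1 (fun x => expR (c * x)) (c * expR (c * x)).
Proof.
have := @is_derive_comp_affine R expR (expR (0 + c * x)) 0 c x (is_derive_expR _).
by rewrite add0r; under eq_fun do rewrite add0r.
Qed.

Lemma integral_expRN (R : realType) (s : R) : 0 < s ->
  (\int[lebesgue_measure]_(t in `]0%R, +oo[) (expR (- s * t))%:E = s^-1%:E)%E.
Proof.
move=> s0.
rewrite integral_itv_obnd_cbnd; last first.
  apply/measurable_EFinP; apply: measurable_funTS.
  by apply: continuous_measurable_fun; exact: continuous_expRZ.
have dF (x : R) : is_derive x 1 (fun t => - s^-1 * expR (- s * t)) (expR (- s * x)).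
  have := is_deriveZ (- s^-1) (is_derive_expRZ (- s) x).
  by rewrite /GRing.scale/= mulrA mulrNN mulVf ?gt_eqF// mul1r.
rewrite (@ge0_continuous_FTC2y R
  (fun t => expR (- s * t)) (fun t => - s^-1 * expR (- s * t)) 0 0).
- by rewrite mulr0 expR0 mulr1 -EFinB sub0r opprK.
- by move=> x _; exact: expR_ge0.
- by apply: continuous_subspaceT; exact: continuous_expRZ.
- rewrite -(mulr0 (- s^-1)); apply: cvgM; first exact: cvg_cst.
  under eq_fun do rewrite mulNr.
  apply: (@cvg_comp _ _ _ (fun x => s * x) (fun x => expR (- x)) _ +oo); last exact: cvgr_expR.
  by apply: gt0_cvgMry => //; exact: cvg_id.
- by move=> x _; case: (dF x).
- apply: cvg_at_right_filter; case: (dF 0) => /derivable1_diffP/differentiable_continuous + _.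
  exact.
- by move=> x _; rewrite derive1E; case: (dF x).
Qed.

(** The quotient is the integral of e^(- s t) over s in [a, b]. Tonelli applies by positivity, and
    integrating in t first leaves the integral of 1 / s. *)
Lemma frullani_expR (R : realType) (a b : R) : 0 < a -> a <= b ->
  (\int[lebesgue_measure]_(t in `]0%R, +oo[) ((expR (- a * t) - expR (- b * t)) / t)%:E =
   (ln b - ln a)%:E)%E.
Proof.
move=> a0 ab.
transitivity (\int[lebesgue_measure]_(t in `]0%R, +oo[)
    \int[lebesgue_measure]_(s in `[a, b]) (expR (- s * t))%:E)%E.
  apply: eq_integral => t; rewrite inE/= in_itv/= andbT => t0.
  have tE (s : R) : - s * t = - t * s by ring.
  under eq_integral do rewrite tE.
  transitivity ((- t^-1 * expR (- t * b) - - t^-1 * expR (- t * a))%:E).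
    by congr EFin; rewrite -!tE; ring.
  apply/esym/(@integral_is_derive R (fun s => - t^-1 * expR (- t * s))) => //.
    by move=> x _; exact: continuous_expRZ.
  move=> x _; have := is_deriveZ (- t^-1) (is_derive_expRZ (- t) x).
  by rewrite /GRing.scale/= mulrA mulrNN mulVf ?gt_eqF// mul1r.
have mK : measurable_fun ((`[a, b] : set R) `*` (`]0, +oo[ : set R))
    (fun z : R * R => expR (- z.1 * z.2)).
  apply: measurable_funTS; apply: measurableT_comp => //.
  by apply: measurable_funM => //; exact: measurableT_comp.
rewrite -(@tonelli_setX R _ _ (fun s t => expR (- s * t)) _ _ mK)//.
transitivity (\int[lebesgue_measure]_(s in `[a, b]) (s^-1)%:E)%E.
  apply: eq_integral => s; rewrite inE/= in_itv/= => /andP[as_ _].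
  by rewrite integral_expRN// (lt_le_trans a0).
apply: (@integral_is_derive R (@ln R) (fun s => s^-1)) => //.
- move=> x; rewrite in_itv/= => /andP[ax _].
  by apply: continuousV; rewrite ?gt_eqF ?(lt_le_trans a0)//; exact: cvg_id.
- by move=> x /andP[ax _]; apply: is_derive1_ln; exact: lt_le_trans ax.
Qed.

(** * Spectrum of circulant Laplacians *)

Lemma mup_prod_XsubC (F : fieldType) (s : seq F) (x : F) :
  mup x (\prod_(y <- s) ('X - y%:P)) = count_mem x s.
Proof.
elim: s => [|y s IH]; first by rewrite big_nil mupNroot// root1.
rewrite big_cons mupM ?polyXsubC_eq0//; last first.
  by rewrite monic_neq0// monic_prod_XsubC.
by rewrite IH -['X - _]expr1 mup_XsubCX /=; case: (y == x).
Qed.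

(** Distinct nonzero eigenvalues are the distinct nonzero entries of [s], and [mup] counts their
    occurrences. *)
Lemma det_star_char_poly_split (F : fieldType) (n : nat) (A : 'M[F]_n) (s : seq F) :
  char_poly A = \prod_(x <- s) ('X - x%:P) ->
  det_star A = \prod_(x <- s | x != 0) x.
Proof.
move=> cA; rewrite -prodr_undup_exp_count /det_star.
have -> : [set x | eigenvalue A x /\ x != 0] = [set` [seq x <- undup s | x != 0]].
  apply/seteqP; split => x /=;
    rewrite eigenvalue_root_char cA root_prod_XsubC mem_filter mem_undup.
    by move=> [-> ->].
  by move=> /andP[].
rewrite -fsbig_seq ?filter_uniq ?undup_uniq// big_filter cA.
by apply: eq_bigr => x _; rewrite mup_prod_XsubC.
Qed.

(** The entries are images of integers, so the spectrum can be computed over the complex numbers,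
    where primitive roots of unity exist, and carried back to the reals. *)
Lemma map_laplacian_mx (R S : nzRingType) (f : {rmorphism R -> S}) (n : nat)
    (Gam : seq nat) :
  map_mx f (laplacian_mx R n Gam) = laplacian_mx S n Gam.
Proof.
apply/matrixP => i j; rewrite !mxE raddf_sum; apply: eq_bigr => y _.
by rewrite raddfMn raddfB /= !mxE !rmorph_nat.
Qed.

Section circulant_spectrum.
Context {F : fieldType} {n : nat} {z : F}.
Hypothesis prim_z : n.-primitive_root z.

Lemma sum_congruence (V : nmodType) (f : nat -> V) (a : nat) :
  (forall k, f (k %% n)%N = f k) ->
  \sum_(y < n) f y *+ (y == a %[mod n])%N = f a.
Proof.
move=> fn; have n0 := prim_order_gt0 prim_z.
rewrite (bigD1 (Ordinal (ltn_pmod a n0)))//= modn_mod eqxx mulr1n fn big1 ?addr0//.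
move=> y; rewrite -val_eqE/= => /negbTE.
by rewrite -(modn_small (ltn_ord y)) modn_mod => ->.
Qed.

(** Characters of Z/nZ diagonalize every translation-invariant operator; a neighbour v + g or v - g
    multiplies the character by its value at g or its inverse. *)
Lemma laplacian_character (Gam : seq nat) (j : nat) :
  laplacian Gam (\row_(k < n) (z ^+ k) ^+ j) =
  (\sum_(g <- Gam) (2 - z ^+ (j * g) - z ^- (j * g))) *:
    (\row_(k < n) (z ^+ k) ^+ j).
Proof.
have n0 := prim_order_gt0 prim_z.
have zn := prim_expr_order prim_z.
pose w := z ^+ j.
have wn : w ^+ n = 1 by rewrite /w -exprM mulnC exprM zn expr1n.
have w0 : w != 0.
  by apply/eqP => w0; move: wn; rewrite w0 expr0n gtn_eqF// => /eqP; rewrite eq_sym oner_eq0.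
have zw k : (z ^+ k) ^+ j = w ^+ k by rewrite /w -!exprM mulnC.
apply/rowP => v; rewrite !mxE zw.
under eq_bigr => y _ do rewrite !mxE !zw /circulant_mult -sumrMnr.
rewrite exchange_big/= mulr_suml; apply: eq_bigr => g _.
under eq_bigr => y _ do rewrite mulrnDr.
rewrite big_split/= (sum_congruence (f := fun y => w ^+ v - w ^+ y)); last first.
  by move=> k; rewrite expr_mod.
(* The congruence is solved for y as v + (n - g mod n), a natural number representing v - g. *)
have -> : \sum_(y < n) (w ^+ v - w ^+ y) *+ (v == y + g %[mod n]) =
          w ^+ v - w ^+ (v + (n - g %% n)).
  rewrite -(sum_congruence (f := fun y => w ^+ v - w ^+ y)); last first.
    by move=> k; rewrite expr_mod.
  apply: eq_bigr => y _; congr (_ *+ nat_of_bool _).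
  rewrite eq_sym -[RHS](eqn_modDr (g %% n)) -addnA subnK; last exact/ltnW/ltn_pmod.
  by rewrite modnDmr modnDr.
have -> : w ^+ (v + (n - g %% n)) = w ^+ v * w ^- g.
  apply: (mulIf (expf_neq0 g w0)); rewrite mulfVK; last exact: expf_neq0.
  rewrite -[w ^+ g](expr_mod _ wn) -exprD -addnA subnK; last exact/ltnW/ltn_pmod.
  by rewrite exprD wn mulr1.
rewrite /= exprD !exprM -/w.
by ring.
Qed.

Lemma prim_root_inj (i j : 'I_n) : z ^+ i = z ^+ j -> i = j.
Proof.
by move=> /eqP; rewrite (eq_prim_root_expr prim_z) !modn_small// => /eqP/val_inj.
Qed.

(** The rows of the Vandermonde matrix V are the characters, so V intertwines the Laplacian with a
    diagonal matrix. Taking determinants of the characteristic matrices and cancelling det V gives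
    all multiplicities at once. *)
Lemma char_poly_laplacian (Gam : seq nat) :
  char_poly (laplacian_mx F n Gam) =
  \prod_(j < n) ('X - (\sum_(g <- Gam) (2 - z ^+ (j * g) - z ^- (j * g)))%:P).
Proof.
pose V := Vandermonde n (\row_(k < n) z ^+ k).
pose D : 'M[F]_n := diag_mx (\row_j \sum_(g <- Gam) (2 - z ^+ (j * g) - z ^- (j * g))).
have VE : V *m laplacian_mx F n Gam = D *m V.
  apply/row_matrixP => j; rewrite row_mul mul_rV_lin1.
  have -> : row j V = \row_(k < n) (z ^+ k) ^+ j by apply/rowP => k; rewrite !mxE.
  rewrite /= laplacian_character; apply/rowP => k.
  by rewrite mul_diag_mx !mxE.
have detV : \det V != 0.
  rewrite det_Vandermonde; apply/prodf_neq0 => i _; apply/prodf_neq0 => j ij.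
  rewrite !mxE subr_eq0; apply: contraTN ij => /eqP/prim_root_inj ->.
  by rewrite ltnn.
have : map_mx polyC V *m char_poly_mx (laplacian_mx F n Gam) =
    char_poly_mx D *m map_mx polyC V.
  by rewrite mulmxBr mulmxBl -!map_mxM VE scalar_mxC.
move=> /(congr1 determinant); rewrite !det_mulmx mulrC.
rewrite {1}/char_poly; move=> /(mulIf (_ : \det (map_mx polyC V) != 0)) ->; last first.
  by rewrite det_map_mx polyC_eq0.
rewrite -/(char_poly D) char_poly_trig ?diag_mx_is_trig//.
by apply: eq_bigr => j _; rewrite !mxE eqxx mulr1n.
Qed.

(** Evaluation at 1 of 1 + X + ... + X^(n-1), the product of the X - z^j over 1 <= j < n. *)
Lemma prod_1_sub_prim_root : \prod_(1 <= j < n) (1 - z ^+ j) = n%:R.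
Proof.
have n0 := prim_order_gt0 prim_z.
have := factor_Xn_sub_1 prim_z.
rewrite big_ltn// expr0 subrX1 => /(mulfI (negbT (polyXsubC_eq0 1))) /(congr1 (horner ^~ 1)).
rewrite horner_prod horner_sum.
under eq_bigr => j _ do rewrite hornerXsubC.
move=> ->.
under eq_bigr => j _ do rewrite hornerXn expr1n.
by rewrite sumr_const card_ord.
Qed.

End circulant_spectrum.

Section cis.
Context {R : realType}.

Definition cis (x : R) : complex R := Complex (cos x) (sin x).

Lemma cisX (x : R) (k : nat) : cis x ^+ k = cis (k%:R * x).
Proof.
elim: k => [|k IH]; first by rewrite expr0 /cis mul0r cos0 sin0.
rewrite exprSr IH -natr1 mulrDl mul1r /cis cosD sinD.
by apply/eqP; rewrite eq_complex /=; apply/andP; split; apply/eqP; ring.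
Qed.

Lemma cisMN (x : R) : cis x * cis (- x) = 1.
Proof.
apply/eqP; rewrite eq_complex /= cosN sinN -(cos2Dsin2 x).
by apply/andP; split; apply/eqP; ring.
Qed.

Lemma cis_neq0 (x : R) : cis x != 0.
Proof.
by apply: contra_eq_neq (cisMN x) => ->; rewrite mul0r eq_sym oner_eq0.
Qed.

Lemma cis_inv (x : R) : (cis x)^-1 = cis (- x).
Proof. by apply: (mulfI (cis_neq0 x)); rewrite divff ?cis_neq0// cisMN. Qed.

Lemma chord2_cis (x : R) :
  real_complex R (chord2 x) = 2 - cis x - (cis x)^-1.
Proof.
rewrite cis_inv; apply/eqP; rewrite eq_complex /= /chord2 cosN sinN.
by apply/andP; split; apply/eqP; ring.
Qed.

Lemma cis_prim_root (n : nat) : (0 < n)%N ->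
  n.-primitive_root (cis (2 * pi / n%:R)).
Proof.
move=> n0; have n0' : 0 < n%:R :> R by rewrite ltr0n.
have pi0 := pi_gt0 R.
have zn : cis (2 * pi / n%:R) ^+ n = 1.
  rewrite cisX (_ : n%:R * (2 * pi / n%:R) = pi *+ 2); last first.
    by rewrite mulr2n; field; rewrite gt_eqF.
  by rewrite /cis cos2pi sin2pi.
have [m mz mn] := prim_order_exists n0 zn.
suff nm : n = m by rewrite {1}nm.
have m0 := prim_order_gt0 mz.
apply/eqP; apply: contraT => nm.
have mltn : (m < n)%N by rewrite ltn_neqAle eq_sym nm dvdn_leq.
(* If the order m were smaller than n, the chord at 2 pi m / n would vanish strictly inside the
   period. *)
have := chord2_cis (m%:R * (2 * pi / n%:R)).
rewrite -cisX (prim_expr_order mz) invr1 => /eqP.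
rewrite (_ : 2 - 1 - 1 = 0); last by ring.
rewrite fmorph_eq0 gt_eqF// chord2_gt0//.
have m0' : 0 < m%:R :> R by rewrite ltr0n.
have mltn' : m%:R < n%:R :> R by rewrite ltr_nat.
rewrite mulr_gt0 ?divr_gt0 ?mulr_gt0//= mulrA ltr_pdivrMr// mulrC ltr_pM2l//.
by rewrite mulr_gt0.
Qed.

End cis.

Definition circulant_symbol (R : realType) (Gam : seq nat) (x : R) : R :=
  \sum_(g <- Gam) chord2 (g%:R * x).

(** Each factor is (1 - z^j) (1 - z^(-j)), and both z and its inverse are primitive roots. This is
    the origin of the term 2 log n. *)
Lemma prod_chord2 (R : realType) (n : nat) : (0 < n)%N ->
  \prod_(1 <= j < n) chord2 (2 * pi * j%:R / n%:R : R) = n%:R ^+ 2.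
Proof.
move=> n0; apply: (fmorph_inj (real_complex R)); rewrite rmorph_prod rmorphXn rmorph_nat.
have zP := cis_prim_root (R := R) n0; set z := cis _ in zP.
have z0 : z != 0 := cis_neq0 _.
have ziP : n.-primitive_root z^-1.
  have -> : z^-1 = conjc z by rewrite cis_inv /z /cis cosN sinN.
  by rewrite fmorph_primitive_root.
rewrite expr2 -{1}(prod_1_sub_prim_root zP) -(prod_1_sub_prim_root ziP) -big_split/=.
apply: eq_bigr => j _; rewrite chord2_cis.
rewrite (_ : 2 * pi * j%:R / n%:R = j%:R * (2 * pi / n%:R)); last by ring.
rewrite -cisX -/z exprVn.
by field; rewrite expf_neq0.
Qed.

Lemma char_poly_circulant (R : realType) (n : nat) (Gam : seq nat) : (0 < n)%N ->
  char_poly (laplacian_mx R n Gam) =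
  \prod_(j < n) ('X - (circulant_symbol Gam (2 * pi * j%:R / n%:R : R))%:P).
Proof.
move=> n0; apply: (map_poly_inj (real_complex R)).
rewrite map_char_poly map_laplacian_mx (char_poly_laplacian (cis_prim_root n0)) rmorph_prod.
apply: eq_bigr => j _; rewrite rmorphB /= map_polyX map_polyC/=; congr (_ - _%:P).
rewrite [RHS]rmorph_sum; apply: eq_bigr => g _.
rewrite (_ : g%:R * (2 * pi * j%:R / n%:R) = (j * g)%:R * (2 * pi / n%:R)).
  by rewrite /= chord2_cis -cisX.
by rewrite natrM; ring.
Qed.

Lemma chord2_ge0 (R : realType) (x : R) : 0 <= chord2 x.
Proof. by rewrite /chord2; have := cos_le1 x; lra. Qed.

Lemma circulant_symbol_gt0 (R : realType) (gam : seq nat) (x : R) :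
  0 < x < 2 * pi -> 0 < circulant_symbol (1%N :: gam) x.
Proof.
move=> x0; rewrite /circulant_symbol big_cons mul1r ltr_pwDl ?chord2_gt0//.
by rewrite sumr_ge0// => g _; exact: chord2_ge0.
Qed.

Lemma circulant_symbol0 (R : realType) (gam : seq nat) : circulant_symbol gam (0 : R) = 0.
Proof.
by rewrite /circulant_symbol big1// => g _; rewrite mulr0 /chord2 cos0; ring.
Qed.

(** The generator 1 connects the graph: its chord alone keeps the symbol positive inside the period,
    so discarding zero eigenvalues removes exactly j = 0. *)
Lemma det_star_circulant (R : realType) (n : nat) (gam : seq nat) : (0 < n)%N ->
  det_star (laplacian_mx R n (1%N :: gam)) =
  \prod_(1 <= j < n) circulant_symbol (1%N :: gam) (2 * pi * j%:R / n%:R).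
Proof.
move=> n0; pose lam j : R := circulant_symbol (1%N :: gam) (2 * pi * j%:R / n%:R).
rewrite (@det_star_char_poly_split _ _ _ [seq lam j | j <- index_iota 0 n]); last first.
  by rewrite char_poly_circulant// big_map big_mkord.
rewrite big_map big_ltn_cond//= {1}/lam mulr0 mul0r circulant_symbol0 eqxx/=.
rewrite big_nat_cond [RHS]big_nat_cond; apply: eq_bigl => j.
have [/andP[j1 jn]|//] := boolP (1 <= j < n)%N.
have pi0 := pi_gt0 R.
rewrite /= gt_eqF// circulant_symbol_gt0//.
have n0' : 0 < n%:R :> R by rewrite ltr0n.
have j0' : 0 < j%:R :> R by rewrite ltr0n.
have jn' : j%:R < n%:R :> R by rewrite ltr_nat.
by rewrite divr_gt0 ?mulr_gt0//= ltr_pdivrMr// ltr_pM2l// mulr_gt0.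
Qed.

(** * Factorization of the symbol *)

(** Squared modulus of the sum of e^(i k x) over k < g. This form avoids dividing by the chord,
    which vanishes at 0, and its plain products suit [second_order_boundedM]. *)
Definition fejer (R : realType) (g : nat) (x : R) : R :=
  (\sum_(k < g) cos (k%:R * x)) * (\sum_(k < g) cos (k%:R * x)) +
  (\sum_(k < g) sin (k%:R * x)) * (\sum_(k < g) sin (k%:R * x)).

Definition reduced_symbol (R : realType) (gam : seq nat) (x : R) : R :=
  1 + \sum_(g <- gam) fejer g x.

Section reduced_symbol.
Context {R : realType}.
Implicit Types (g : nat) (gam : seq nat) (x : R).

Lemma chord2_mul_fejer g x : chord2 (g%:R * x) = chord2 x * fejer g x.
Proof.
(* Real and imaginary parts of (1 - z) * sum_(k < g) z^k = 1 - z^g at z = e^(i x). *)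
have [h1 h2] : (1 - cos x) * (\sum_(k < g) cos (k%:R * x)) +
       sin x * (\sum_(k < g) sin (k%:R * x)) = 1 - cos (g%:R * x) /\
    (1 - cos x) * (\sum_(k < g) sin (k%:R * x)) -
       sin x * (\sum_(k < g) cos (k%:R * x)) = - sin (g%:R * x).
  elim: g => [|g [IH1 IH2]].
    by rewrite !big_ord0 mul0r cos0 sin0; split; ring.
  rewrite !big_ord_recr/= -natr1 [(g%:R + 1) * x]mulrDl mul1r cosD sinD.
  by split; [move: IH1|move: IH2] => H; lra.
rewrite /chord2 /fejer.
set C := \sum_(k < g) _ in h1 h2 *; set S := \sum_(k < g) _ in h1 h2 *.
transitivity ((1 - cos (g%:R * x)) ^+ 2 + (- sin (g%:R * x)) ^+ 2).
  by rewrite sqrrN sin2cos2; ring.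
rewrite -h1 -h2.
transitivity (((1 - cos x) ^+ 2 + sin x ^+ 2) * (C * C + S * S)); first by ring.
by congr (_ * _); rewrite sin2cos2; ring.
Qed.

Lemma fejer_ge0 g x : 0 <= fejer g x.
Proof. by rewrite /fejer -!expr2 addr_ge0// sqr_ge0. Qed.

Lemma fejer0 g : fejer g (0 : R) = (g ^ 2)%:R.
Proof.
rewrite /fejer; under eq_bigr do rewrite mulr0 cos0.
under [X in _ + X * _]eq_bigr do rewrite mulr0 sin0.
by rewrite sumr_const card_ord big1// mul0r addr0 -natrM.
Qed.

Lemma fejerN g x : fejer g (- x) = fejer g x.
Proof.
rewrite /fejer; under eq_bigr do rewrite mulrN cosN.
under [X in _ + X * _]eq_bigr do rewrite mulrN sinN.
by under [X in _ + _ * X]eq_bigr do rewrite mulrN sinN; rewrite sumrN mulrNN.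
Qed.

Lemma fejer_periodic g x : fejer g (x + 2 * pi) = fejer g x.
Proof.
have E (k : 'I_g) : k%:R * (x + 2 * pi) = k%:R * x + pi *+ 2 *+ k.
  by rewrite mulrDr -[pi *+ 2 *+ k]mulr_natl -[pi *+ 2]mulr_natl.
rewrite /fejer; under eq_bigr do rewrite E (periodicn (@cosD2pi R)).
under [X in _ + X * _]eq_bigr do rewrite E (periodicn (@sinD2pi R)).
by under [X in _ + _ * X]eq_bigr do rewrite E (periodicn (@sinD2pi R)).
Qed.

Lemma second_order_bounded_fejer g : second_order_bounded (@fejer R g).
Proof.
apply: second_order_boundedD; apply: second_order_boundedM;
  apply: second_order_bounded_sum => k;
  by have [] := second_order_bounded_cos_sin (k%:R : R).
Qed.

Lemma circulant_symbolE gam x :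
  circulant_symbol (1%N :: gam) x = chord2 x * reduced_symbol gam x.
Proof.
rewrite /circulant_symbol /reduced_symbol big_cons mul1r mulrDr mulr1 mulr_sumr.
by congr (_ + _); apply: eq_bigr => g _; exact: chord2_mul_fejer.
Qed.

Lemma reduced_symbol_ge1 gam x : 1 <= reduced_symbol gam x.
Proof. by rewrite lerDl sumr_ge0// => g _; exact: fejer_ge0. Qed.

Lemma reduced_symbol_gt0 gam x : 0 < reduced_symbol gam x.
Proof. exact: lt_le_trans (reduced_symbol_ge1 gam x). Qed.

Lemma reduced_symbol0 gam : reduced_symbol gam (0 : R) = (c_Gam gam)%:R.
Proof.
rewrite /reduced_symbol /c_Gam natrD natr_sum; congr (_ + _).
by apply: eq_bigr => g _; exact: fejer0.
Qed.

Lemma reduced_symbolN gam x : reduced_symbol gam (- x) = reduced_symbol gam x.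
Proof. by congr (_ + _); apply: eq_bigr => g _; exact: fejerN. Qed.

Lemma reduced_symbol_periodic gam x :
  reduced_symbol gam (x + 2 * pi) = reduced_symbol gam x.
Proof. by congr (_ + _); apply: eq_bigr => g _; exact: fejer_periodic. Qed.

Lemma second_order_bounded_ln_reduced_symbol gam :
  second_order_bounded (fun x => ln (reduced_symbol gam x)).
Proof.
apply: second_order_bounded_ln; last exact: reduced_symbol_ge1.
apply: second_order_boundedD; first exact: second_order_bounded_cst.
by apply: second_order_bounded_sum => g; exact: second_order_bounded_fejer.
Qed.

End reduced_symbol.

(** * The heat-kernel integral *)

(** The sign of the integrand is that of l - 1, so the two cases exchange the parameters of
    [frullani_expR]. The first equality reduces the absolute integrability required by [fubini_setX]
    to integrability of ln lam. *)
Lemma frullani_ln (R : realType) (l : R) : 0 < l ->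
  (\int[lebesgue_measure]_(t in `]0%R, +oo[)
     `|(expR (- t) - expR (- (t * l))) / t|%:E = `|ln l|%:E)%E /\
  (\int[lebesgue_measure]_(t in `]0%R, +oo[)
     ((expR (- t) - expR (- (t * l))) / t)%:E = (ln l)%:E)%E.
Proof.
move=> l0.
have E (t : R) : expR (- t) - expR (- (t * l)) = expR (- 1 * t) - expR (- l * t).
  by congr (expR _ - expR _); ring.
have [l1|l1] := leP 1 l.
  have Il := frullani_expR ltr01 l1.
  rewrite ln1 subr0 in Il.
  split; last by under eq_integral do rewrite E.
  rewrite ger0_norm ?ln_ge0// -Il; apply: eq_integral => t.
  rewrite inE/= in_itv/= andbT => t0; congr EFin.
  rewrite E ger0_norm// divr_ge0 ?(ltW t0)// subr_ge0 ler_expR !mulNr lerN2.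
  by rewrite ler_wpM2r// ltW.
have Il := frullani_expR l0 (ltW l1).
rewrite ln1 sub0r in Il.
have f0 (t : R) : 0 < t -> 0 <= (expR (- l * t) - expR (- 1 * t)) / t.
  move=> t0; rewrite divr_ge0 ?(ltW t0)// subr_ge0 ler_expR !mulNr lerN2.
  by rewrite ler_wpM2r// ltW.
have E' (t : R) : (expR (- t) - expR (- (t * l))) / t =
    - ((expR (- l * t) - expR (- 1 * t)) / t) by rewrite E; ring.
split.
  rewrite ler0_norm ?ln_le0 ?(ltW l1)// -Il; apply: eq_integral => t.
  rewrite inE/= in_itv/= andbT => t0; congr EFin.
  by rewrite E' normrN ger0_norm// f0.
under eq_integral do rewrite E' EFinN.
rewrite integral_ge0N ?Il ?EFinN ?oppeK//.
by move=> t; rewrite /= in_itv/= andbT => t0; rewrite lee_fin f0.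
Qed.

Lemma continuous_circulant_symbol (R : realType) (Gam : seq nat) :
  continuous (@circulant_symbol R Gam).
Proof.
rewrite /circulant_symbol; elim: Gam => [|g Gam IH] x.
  by under eq_fun do rewrite big_nil; exact: cvg_cst.
have cg : {for x, continuous (fun x : R => chord2 (g%:R * x))}.
  apply: (@continuous_comp _ _ _ (fun x : R => g%:R * x) (@chord2 R)).
    by apply: cvgM; [exact: cvg_cst|exact: cvg_id].
  exact: continuous_chord2.
by under eq_fun do rewrite big_cons; exact: (cvgD cg (IH x)).
Qed.

Lemma ln_circulant_symbol_integral (R : realType) (gam : seq nat) :
  let G (w : R) := ln (reduced_symbol gam w) in
  (@lebesgue_measure R).-integrable `]0, pi]
    (fun w => (ln (circulant_symbol (1%N :: gam) w))%:E) /\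
  (\int[lebesgue_measure]_(w in `]0%R, pi])
     (ln (circulant_symbol (1%N :: gam) w))%:E =
   (\int[lebesgue_measure]_(w in `[0%R, pi]) G w)%R%:E)%E.
Proof.
move=> G; pose mu := @lebesgue_measure R; have pi0 := pi_gt0 R.
have [ic Ic] := ln_chord2_integral R.
have iG : mu.-integrable `[0, pi] (fun w => (G w)%:E).
  apply: (@continuous_compact_integrable _ G); first exact: segment_compact.
  apply: continuous_subspaceT; apply: second_order_bounded_continuous.
  exact: second_order_bounded_ln_reduced_symbol.
have iG' : mu.-integrable `]0, pi] (fun w => (G w)%:E).
  by apply: integrableS iG => //; apply: subset_itvr; rewrite bnd_simp.
have lnE (w : R) : w \in [set` `]0, pi]] ->
    (ln (chord2 w) + G w)%:E = (ln (circulant_symbol (1%N :: gam) w))%:E.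
  rewrite inE/= in_itv/= => w0; rewrite circulant_symbolE lnM ?posrE//.
    by apply: chord2_gt0; lra.
  exact: reduced_symbol_gt0.
split.
  by apply: (@eq_integrable _ _ _ mu _ _ _ _ lnE) => //; exact: (integrableD _ ic iG').
have <- : (\int[mu]_(w in `]0%R, pi]) (ln (chord2 w) + G w)%:E =
    \int[mu]_(w in `]0%R, pi]) (ln (circulant_symbol (1%N :: gam) w))%:E)%E.
  by apply: eq_integral => w /lnE.
rewrite integralD_EFin//.
have -> : (\int[mu]_(w in `]0%R, pi]) (ln (chord2 w))%:E = 0)%E.
  by move: Ic; rewrite /Rintegral => Ic; rewrite -[LHS]fineK ?Ic// integrable_fin_num.
rewrite add0e -Rintegral_itv_obnd_cbnd//.
by rewrite /Rintegral fineK// integrable_fin_num.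
Qed.

Lemma continuous_expR_circulant_symbol (R : realType) (Gam : seq nat) (t : R) :
  continuous (fun w => expR (- (t * circulant_symbol Gam w))).
Proof.
move=> w; apply: (@continuous_comp _ _ _ (fun w => - (t * circulant_symbol Gam w)) expR).
  apply: cvgN; apply: cvgM; first exact: cvg_cst.
  exact: continuous_circulant_symbol.
exact: continuous_expR.
Qed.

(** The exponent is 2 d t - t lam(w). Evenness of lam then halves the interval, which leaves the
    zero of lam at an endpoint. *)
Lemma besselI0E (R : realType) (d : nat) (gam : seq nat) (t : R) :
  d = (size gam).+1 ->
  expR (- (2 * d%:R * t)) * besselI0 gam (2 * t) =
  pi^-1 * (\int[lebesgue_measure]_(w in `[0%R, pi])
     expR (- (t * circulant_symbol (1%N :: gam) w)))%R.
Proof.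
move=> dE; have pi0 := pi_gt0 R.
pose k (w : R) := expR (- (t * circulant_symbol (1%N :: gam) w)).
have ck : continuous k by exact: continuous_expR_circulant_symbol.
have kE w : expR (2 * t * (cos w + \sum_(g <- gam) cos (g%:R * w))) =
    expR (2 * d%:R * t) * k w.
  rewrite -expRD; congr expR.
  rewrite /circulant_symbol big_cons mul1r /chord2 sumrB -mulr_sumr.
  rewrite big_const_seq count_predT iter_addr_0 dE -natr1 -mulr_natr; ring.
have sk x : k (0 - x) = k (0 + x).
  by rewrite sub0r add0r /k !circulant_symbolE reduced_symbolN /chord2 cosN.
have [+ _] := symmetric_integral (ltW pi0) (fun x _ => ck x) sk.
rewrite sub0r add0r => Ik.
rewrite /besselI0; under eq_Rintegral do rewrite kE.
rewrite RintegralZl//; last first.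
  apply: continuous_compact_integrable; first exact: segment_compact.
  exact: continuous_subspaceT.
have pn0 : pi != 0 :> R by rewrite gt_eqF.
(* pi is generalized because ring and field unfold it to (pi / 2) *+ 2. *)
rewrite Ik expRN; set I := Rintegral _ _ _.
move: {k ck kE sk Ik} I (@pi R) pn0 => I p pn0.
by field; rewrite pn0 expR_eq0.
Qed.

(** The constant e^(- t) is its own mean over ]0, pi], so it moves under the integral in w and forms
    a Frullani integrand for each w. *)
Lemma circulant_integrandE (R : realType) (d : nat) (gam : seq nat) (t : R) :
  d = (size gam).+1 -> 0 < t ->
  (circulant_integrand d gam t)%:E =
  (pi^-1%:E * \int[lebesgue_measure]_(w in `]0%R, pi])
    ((expR (- t) - expR (- (t * circulant_symbol (1%N :: gam) w))) / t)%:E)%E.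
Proof.
move=> dE t0; pose mu := @lebesgue_measure R; have pi0 := pi_gt0 R.
pose k (w : R) := expR (- (t * circulant_symbol (1%N :: gam) w)).
have int_cont (h : R -> R) : continuous h -> mu.-integrable `[0, pi] (EFin \o h).
  move=> ch; apply: continuous_compact_integrable; first exact: segment_compact.
  exact: continuous_subspaceT.
have ik := int_cont _ (@continuous_expR_circulant_symbol R (1%N :: gam) t).
have ic : mu.-integrable `[0, pi] (EFin \o (fun=> expR (- t))).
  by apply: int_cont => x; exact: cvg_cst.
have ikc : mu.-integrable `[0, pi] (EFin \o (fun w => (expR (- t) - k w))).
  exact: (integrableB _ ic ik).
have ikc' : mu.-integrable `[0, pi] (EFin \o (fun w => (expR (- t) - k w) / t)).
  exact: (integrableZr _ t^-1 ikc).
rewrite integral_itv_obnd_cbnd; last first.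
  apply: measurable_funS (measurable_int _ ikc') => //.
  by apply: subset_itvr; rewrite bnd_simp.
rewrite -[X in (_ * X)%E]fineK; last exact: integrable_fin_num ikc'.
rewrite -EFinM; congr EFin.
transitivity (pi^-1 * (\int[mu]_(w in `[0%R, pi]) ((expR (- t) - k w) / t))%R); last by [].
rewrite RintegralZr// RintegralB// Rintegral_cst// /circulant_integrand besselI0E//.
have -> : fine (mu `[0, pi]%classic) = pi.
  by rewrite /mu lebesgue_measure_itv/= lte_fin pi0 oppr0 adde0.
have pn0 : pi != 0 :> R by rewrite gt_eqF.
set I := Rintegral _ _ _; move: I (@pi R) pn0 => I p pn0.
by field; rewrite pn0 (gt_eqF t0).
Qed.

Lemma circulant_integrand_integral (R : realType) (d : nat) (gam : seq nat) :
  d = (size gam).+1 ->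
  (@lebesgue_measure R).-integrable `]0, +oo[
     (fun t : R => (circulant_integrand d gam t)%:E) /\
  (\int[@lebesgue_measure R]_(t in `]0%R, +oo[) circulant_integrand d gam t =
   pi^-1 * \int[@lebesgue_measure R]_(w in `[0%R, pi]) ln (reduced_symbol gam w))%R.
Proof.
move=> dE; pose mu := @lebesgue_measure R; have pi0 := pi_gt0 R.
pose lam : R -> R := circulant_symbol (1%N :: gam).
pose f (t w : R) := (expR (- t) - expR (- (t * lam w))) / t.
have lam0 w : 0 < w <= pi -> 0 < lam w.
  by move=> w0; apply: circulant_symbol_gt0; lra.
have mlam : measurable_fun setT lam.
  by apply: continuous_measurable_fun; exact: continuous_circulant_symbol.
have mf : measurable_fun ((`]0, +oo[ : set R) `*` (`]0, pi] : set R))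
    (fun z : R * R => f z.1 z.2).
  (* On ]0, +oo[, 1 / t = expR (- ln t). *)
  apply: (@eq_measurable_fun _ _ _ _ _ (fun z : R * R =>
    (expR (- z.1) - expR (- (z.1 * lam z.2))) * expR (- ln z.1))).
    move=> [t w]; rewrite inE/= => -[]; rewrite in_itv/= andbT => t0 _.
    by rewrite /f/= [expR (- ln t)]expRN lnK.
  apply: measurable_funTS; apply: measurable_funM.
    apply: measurable_funB; apply: measurableT_comp => //.
      exact: measurableT_comp.
    apply: measurableT_comp => //; apply: measurable_funM => //.
    exact: measurableT_comp.
  apply: measurableT_comp => //; apply: measurableT_comp => //.
  exact: measurableT_comp.
have [il Il] := ln_circulant_symbol_integral R gam.
(* The inner integral is |ln lam(w)|, so finiteness is the integrability [il]. *)
have fioo : (\int[mu]_(w in `]0%R, pi]) \int[mu]_(t in `]0%R, +oo[) `|f t w|%:E < +oo)%E.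
  have /integrableP[_] := il.
  congr (_ < _)%E; apply: eq_integral => w; rewrite inE/= in_itv/= => w0.
  by rewrite (frullani_ln (lam0 _ w0)).1.
have [iF IF] := fubini_setX (measurable_itv _) (measurable_itv _) mf fioo.
have cE (t : R) : t \in [set` `]0, +oo[] ->
    (pi^-1%:E * \int[mu]_(w in `]0%R, pi]) (f t w)%:E)%E = (circulant_integrand d gam t)%:E.
  by rewrite inE/= in_itv/= andbT => t0; rewrite (circulant_integrandE dE t0).
have ic : mu.-integrable `]0, +oo[ (fun t : R => (circulant_integrand d gam t)%:E).
  by apply: eq_integrable (integrableZl _ pi^-1 iF) => // t; exact: cE.
split => //; apply: EFin_inj; rewrite EFinM -Il.
rewrite /Rintegral fineK; last exact: integrable_fin_num.
have <- : (\int[mu]_(t in `]0%R, +oo[) (pi^-1%:E * \int[mu]_(w in `]0%R, pi]) (f t w)%:E) =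
    \int[mu]_(t in `]0%R, +oo[) (circulant_integrand d gam t)%:E)%E.
  by apply: eq_integral => t /cE.
rewrite integralZl// IF; congr (_ * _)%E.
apply: eq_integral => w; rewrite inE/= in_itv/= => w0.
by rewrite (frullani_ln (lam0 _ w0)).2.
Qed.

(** * Asymptotics of the determinant *)

Lemma ln_prod_seq (R : realType) (I : eqType) (s : seq I) (F : I -> R) :
  (forall i, i \in s -> 0 < F i) -> ln (\prod_(i <- s) F i) = \sum_(i <- s) ln (F i).
Proof.
move=> F0; suff [] : 0 < \prod_(i <- s) F i /\
    ln (\prod_(i <- s) F i) = \sum_(i <- s) ln (F i) by [].
elim: s F0 => [|i s IH] F0; first by rewrite !big_nil ln1.
have Fi : 0 < F i by apply: F0; rewrite mem_head.
have [s0 sE] := IH (fun j js => F0 j (mem_behead (s := i :: s) js)).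
by rewrite !big_cons mulr_gt0// lnM ?posrE// sE.
Qed.

Lemma ln_det_star_circulant (R : realType) (n : nat) (gam : seq nat) : (0 < n)%N ->
  ln (det_star (laplacian_mx R n (1%N :: gam))) =
  2 * ln n%:R - ln (c_Gam gam)%:R +
  \sum_(j < n) ln (reduced_symbol gam (2 * pi * j%:R / n%:R)).
Proof.
move=> n0; rewrite det_star_circulant//.
under eq_bigr do rewrite circulant_symbolE.
rewrite big_split/= prod_chord2// lnM ?posrE ?exprn_gt0 ?ltr0n//; last first.
  by rewrite prodr_gt0// => j _; exact: reduced_symbol_gt0.
rewrite ln_prod_seq; last by move=> j _; exact: reduced_symbol_gt0.
rewrite -(big_mkord xpredT (fun j => ln (reduced_symbol gam (2 * pi * j%:R / n%:R)))).
rewrite [in RHS]big_ltn// mulr0 mul0r reduced_symbol0.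
by rewrite lnXn ?ltr0n// -[ln n%:R *+ 2]mulr_natl addrA subrK.
Qed.

Theorem theorem1p1 (R : realType) (d : nat) (hd : (1 <= d)%N)
    (gam : (d.-1).-tuple nat) (hgam : path leq 1%N gam) :
  (@lebesgue_measure R).-integrable `]0, +oo[
     (fun t : R => (circulant_integrand d gam t)%:E) /\
  (fun n : nat =>
     ln (det_star (laplacian_mx R n (1%N :: gam))) -
     (n%:R * (\int[@lebesgue_measure R]_(t in `]0%R, +oo[)
                circulant_integrand d gam t)%R
      + 2 * ln n%:R - ln (c_Gam gam)%:R))
    @ within [set n : nat | (last 0 gam <= n./2)%N] \oo --> (0 : R).
Proof.
have dE : d = (size gam).+1 by rewrite size_tuple prednK.
have [ic ->] := circulant_integrand_integral R dE.
split => //; apply: cvg_within_filter.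
pose G (x : R) := ln (reduced_symbol gam x).
have [C GC] := @second_order_bounded_ln_reduced_symbol R gam.
have pi0 := pi_gt0 R; have pi20 : 0 < 2 * pi :> R by rewrite mulr_gt0.
have pG x : G (x + 2 * pi) = G x by rewrite /G reduced_symbol_periodic.
(* Evenness and 2 pi-periodicity give reflection symmetry about pi, which folds the mean over
   [0, 2 pi] into the mean over [0, pi] found on the heat-kernel side. *)
have sG x : G (pi - x) = G (pi + x).
  have -> : pi + x = - (pi - x) + 2 * pi by ring.
  by rewrite pG /G reduced_symbolN.
have cG : continuous G by apply: second_order_bounded_continuous; exists C.
have [_ +] := symmetric_integral (ltW pi0) (fun x _ => cG x) sG.
rewrite subrr (_ : pi + pi = 2 * pi :> R); last by ring.
move=> IG; apply/cvgr0Pnorm_le => e e0; near=> n.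
have n0 : (0 < n)%N by near: n; exact: nbhs_infty_gt.
have n0' : 0 < n%:R :> R by rewrite ltr0n.
rewrite ln_det_star_circulant//.
have := periodic_riemann_sum_error pi20 n0 GC pG; rewrite IG.
set I := Rintegral _ _ _; set S := \sum_(j < n) _ => err.
rewrite [X in `|X|](_ : _ = S - n%:R / (2 * pi) * (2 * I)); last first.
  have pn0 : pi != 0 :> R by rewrite gt_eqF.
  move: S I (@pi R) pn0 {err} => S I p pn0.
  by field.
apply: (le_trans err); rewrite ler_pdivrMr// [e * _]mulrC -ler_pdivrMr//.
by near: n; exact: nbhs_infty_ger.
Unshelve. all: by end_near. Qed.
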